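(* Every matrix $A\in\mathrm{GL}(2,\mathbb Z)$ admits a quaternionic lift $$F_\Phi:\mathbb S^3\times\mathbb S^3\longrightarrow\mathbb S^3\times\mathbb S^3$$ which is a real-analytic diffeomorphism. Such a lift can be constructed by factoring $A$ into elementary integral matrices and replacing the factors by the corresponding Nielsen transformations.
   Context: $\mathbb S^3$ is the Lie group of unit quaternions, identified with $\mathrm{SU}(2)$. $F_2=\langle x,y\rangle$ is the free group on $x,y$. For a word $w\in F_2$ and a pair $(q_1,q_2)\in\mathrm{SU}(2)^2$, $w(q_1,q_2)$ is the element obtained by substituting $q_1$ for $x$ and $q_2$ for $y$. For $\Phi\in\operatorname{Aut}(F_2)$ with $\Phi(x)=w_1$, $\Phi(y)=w_2$, the associated map is $F_\Phi(q_1,q_2)=(w_1(q_1,q_2),w_2(q_1,q_2))$. The row exponent matrix $\mathrm R(\Phi)\in\mathrm{GL}(2,\mathbb Z)$ has as first row the exponent sums (in $x$ and in $y$) of $\Phi(x)$ and as second row those of $\Phi(y)$. A quaternionic lift of $A\in\mathrm{GL}(2,\mathbb Z)$ is a map $F_\Phi$ for which $\mathrm R(\Phi)=A$. An elementary Nielsen transformation is an automorphism of $F_2$ obtained by one of the following operations on the free basis: interchanging the two generators, replacing one generator by its inverse, or multiplying one generator on the left or on the right by the other; examples are $(x,y)\mapsto(xy,y)$, $(x,y)\mapsto(x,xy)$, $(x,y)\mapsto(x^{-1},y)$ and $(x,y)\mapsto(y,x)$. A Nielsen transformation corresponds to a matrix through its row exponent matrix; $\mathrm R$ is an anti-homomorphism,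 $\mathrm R(\Phi\circ\Psi)=\mathrm R(\Psi)\mathrm R(\Phi)$, and $F_\Phi\circ F_\Psi=F_{\Psi\circ\Phi}$. *)

(* Defs.v *)
From HB Require Import structures.
From mathcomp Require Import all_boot all_order all_fingroup all_algebra.
From mathcomp Require Import all_classical all_reals all_analysis.
From mathcomp Require Import ring.
Import Order.TTheory GRing.Theory Num.Theory.
Import numFieldNormedType.Exports.

Set Implicit Arguments.
Unset Strict Implicit.
Unset Printing Implicit Defensive.

Local Open Scope classical_set_scope.
Local Open Scope ring_scope.

(* The free group on two generators, as the group of reduced words.           *)
(* The letter (i, false) is the i-th generator, (i, true) its inverse.        *)

Definition letter : Type := ('I_2 * bool)%type.

Definition linv (a : letter) : letter := (a.1, ~~ a.2).

Definition reduced (w : seq letter) : bool :=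
  sorted (fun a b : letter => b != linv a) w.

Definition push (a : letter) (w : seq letter) : seq letter :=
  if w is b :: w' then if b == linv a then w' else a :: w else [:: a].

Definition reduce (w : seq letter) : seq letter := foldr push [::] w.

Definition free2 : Type := {w : seq letter | reduced w}.

HB.instance Definition _ := [Choice of free2 by <:].

Lemma linvK : involutive linv.
Proof. by case=> i b; rewrite /linv negbK. Qed.

Lemma push_reduced a w : reduced w -> reduced (push a w).
Proof.
case: w => [|b w] //= rw; case: ifPn => [_|ba]; first exact: path_sorted rw.
by rewrite /reduced /= ba.
Qed.

Lemma foldr_push_reduced u w : reduced w -> reduced (foldr push w u).
Proof. by move=> rw; elim: u => //= a u; exact: push_reduced. Qed.

Lemma reduce_reduced w : reduced (reduce w).
Proof. exact: foldr_push_reduced. Qed.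

Lemma reduce_id w : reduced w -> reduce w = w.
Proof.
elim: w => //= a w IHw rw; rewrite -/(reduce w) IHw; last exact: path_sorted rw.
by case: w rw {IHw} => [|b w] //= /andP[/negPf ->].
Qed.

Lemma pushK a w : reduced w -> push a (push (linv a) w) = w.
Proof.
case: w => [|b w] /=; first by rewrite eqxx.
rewrite linvK; case: eqVneq => [-> | _ _ /=]; last by rewrite eqxx.
by case: w => //= c w /andP[/negPf ->].
Qed.

Lemma foldr_push_push a u w : reduced w ->
  foldr push w (push a u) = push a (foldr push w u).
Proof.
move=> rw; case: u => //= b u; case: eqP => //= ->.
by rewrite pushK // foldr_push_reduced.
Qed.

Lemma foldr_push_reduce u w : reduced w ->
  foldr push w (reduce u) = foldr push w u.
Proof. by move=> rw; elim: u => //= a u IHu; rewrite foldr_push_push // IHu. Qed.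

Lemma reduce_catr u v : reduce (u ++ reduce v) = reduce (u ++ v).
Proof.
by rewrite /reduce !foldr_cat -/(reduce (reduce v)) reduce_id // reduce_reduced.
Qed.

Lemma reduce_catl u v : reduce (reduce u ++ v) = reduce (u ++ v).
Proof. by rewrite /reduce !foldr_cat foldr_push_reduce // reduce_reduced. Qed.

Definition free2_one : free2 := exist _ [::] isT.

Definition free2_mul (u v : free2) : free2 :=
  exist _ (reduce (val u ++ val v)) (reduce_reduced _).

Definition free2_inv (u : free2) : free2 :=
  exist _ (reduce (rev (map linv (val u)))) (reduce_reduced _).

Lemma free2_mulA : associative free2_mul.
Proof.
by move=> u v w; apply/val_inj; rewrite /= reduce_catr reduce_catl catA.
Qed.

Lemma free2_mul1g : left_id free2_one free2_mul.
Proof. by move=> u; apply/val_inj; rewrite /= reduce_id // (valP u). Qed.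

Lemma free2_mulg1 : right_id free2_one free2_mul.
Proof. by move=> u; apply/val_inj; rewrite /= cats0 reduce_id // (valP u). Qed.

Lemma reduce_rev_linv w : reduce (rev (map linv w) ++ w) = [::].
Proof.
elim: w => //= a w IHw; rewrite rev_cons cat_rcons {1}/reduce foldr_cat /=.
have := pushK (linv a) (reduce_reduced w); rewrite linvK => ->.
by rewrite -foldr_cat.
Qed.

Lemma free2_mulVg : left_inverse free2_one free2_inv free2_mul.
Proof.
by move=> u; apply/val_inj; rewrite /= reduce_catl reduce_rev_linv.
Qed.

Lemma free2_mulgV : right_inverse free2_one free2_inv free2_mul.
Proof.
move=> u; apply/val_inj; rewrite /= reduce_catr.
have /= := reduce_rev_linv (rev (map linv (val u))).
by rewrite map_rev revK -map_comp (@eq_map _ _ _ id) ?map_id //; exact: linvK.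
Qed.

HB.instance Definition _ := isGroup.Build free2
  free2_mulA free2_mul1g free2_mulg1 free2_mulVg free2_mulgV.

Definition gen (i : 'I_2) : free2 := exist _ [:: (i, false)] isT.

Definition automorphism (Phi : free2 -> free2) : Prop :=
  {morph Phi : u v / (u * v)%g} /\ bijective Phi.

Definition exponent_sum (j : 'I_2) (w : free2) : int :=
  \sum_(a <- val w | a.1 == j) (-1) ^+ a.2.

Definition row_exponent_mx (Phi : free2 -> free2) : 'M[int]_2 :=
  \matrix_(i, j) exponent_sum j (Phi (gen i)).

Definition letter_map (G : groupType) (q : G * G) (a : letter) : G :=
  let g := if a.1 == 0 then q.1 else q.2 in if a.2 then (g^-1)%g else g.

Definition word_map (G : groupType) (q : G * G) (w : free2) : G :=
  (\prod_(a <- val w) letter_map q a)%g.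

Definition aut_map (G : groupType) (Phi : free2 -> free2) (q : G * G) : G * G :=
  (word_map q (Phi (gen 0)), word_map q (Phi (gen 1))).

Lemma letter_map_linv (G : groupType) (q : G * G) a :
  letter_map q (linv a) = ((letter_map q a)^-1)%g.
Proof. by case: a => i [] //=; rewrite /letter_map /= invgK. Qed.

Lemma word_mapM (G : groupType) (q : G * G) :
  {morph word_map q : u v / (u * v)%g}.
Proof.
have red w : (\prod_(a <- reduce w) letter_map q a =
              \prod_(a <- w) letter_map q a)%g.
  elim: w => //= a w IHw; rewrite -/(reduce w) big_cons -IHw.
  case: (reduce w) => [|b s] /=; first by rewrite big_cons.
  case: eqP => [->|_]; last by rewrite !big_cons.
  by rewrite big_cons letter_map_linv mulVKg.
by move=> u v; rewrite /word_map /= red big_cat.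
Qed.

Lemma word_map_gen (G : groupType) (q : G * G) :
  (word_map q (gen 0) = q.1) * (word_map q (gen 1) = q.2).
Proof. by rewrite /word_map /= !big_seq1. Qed.

(* The group of unit quaternions; a + b i + c j + d k is the row (a, b, c, d) *)

Section UnitQuaternions.
Variable R : realType.
Implicit Types p q : 'rV[R]_4.

Definition quat (a b c d : R) : 'rV[R]_4 := \row_k nth 0 [:: a; b; c; d] k.

Definition quat_mul p q : 'rV[R]_4 :=
  let: (a1, b1, c1, d1) := (p 0 0, p 0 1, p 0 2, p 0 3) in
  let: (a2, b2, c2, d2) := (q 0 0, q 0 1, q 0 2, q 0 3) in
  quat (a1 * a2 - b1 * b2 - c1 * c2 - d1 * d2)
       (a1 * b2 + b1 * a2 + c1 * d2 - d1 * c2)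
       (a1 * c2 - b1 * d2 + c1 * a2 + d1 * b2)
       (a1 * d2 + b1 * c2 - c1 * b2 + d1 * a2).

Definition quat_conj p : 'rV[R]_4 :=
  quat (p 0 0) (- p 0 1) (- p 0 2) (- p 0 3).

Definition quat_normsq p : R := \sum_k p 0 k ^+ 2.

Definition sphere3 : Type := {q : 'rV[R]_4 | quat_normsq q == 1}.

HB.instance Definition _ := [Choice of sphere3 by <:].

Lemma quatE a b c d :
  ((quat a b c d 0 0 = a) * (quat a b c d 0 1 = b) *
   (quat a b c d 0 2 = c) * (quat a b c d 0 3 = d))%type.
Proof. by rewrite !mxE. Qed.

Lemma quatP p q : p 0 0 = q 0 0 -> p 0 1 = q 0 1 -> p 0 2 = q 0 2 ->
  p 0 3 = q 0 3 -> p = q.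
Proof.
move=> e0 e1 e2 e3; apply/rowP => -[[|[|[|[|//]]]] k4].
- by rewrite (_ : Ordinal k4 = 0) //; exact/val_inj.
- by rewrite (_ : Ordinal k4 = 1) //; exact/val_inj.
- by rewrite (_ : Ordinal k4 = 2) //; exact/val_inj.
- by rewrite (_ : Ordinal k4 = 3) //; exact/val_inj.
Qed.

Lemma quat_normsqE q :
  quat_normsq q = q 0 0 ^+ 2 + q 0 1 ^+ 2 + q 0 2 ^+ 2 + q 0 3 ^+ 2.
Proof.
rewrite /quat_normsq !big_ord_recr big_ord0 /= add0r.
by do ![congr (_ + _)]; congr (q 0 _ ^+ 2); exact/val_inj.
Qed.

Lemma quat_normsqM p q :
  quat_normsq (quat_mul p q) = quat_normsq p * quat_normsq q.
Proof. by rewrite !quat_normsqE !quatE; ring. Qed.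

Lemma quat_normsq_conj q : quat_normsq (quat_conj q) = quat_normsq q.
Proof. by rewrite !quat_normsqE !quatE; ring. Qed.

Lemma quat_normsq1 : quat_normsq (quat 1 0 0 0) == 1.
Proof. by apply/eqP; rewrite quat_normsqE !quatE; ring. Qed.

Lemma sphere3_mul_subproof (p q : sphere3) :
  quat_normsq (quat_mul (val p) (val q)) == 1.
Proof. by rewrite quat_normsqM (eqP (valP p)) (eqP (valP q)) mulr1. Qed.

Lemma sphere3_inv_subproof (q : sphere3) :
  quat_normsq (quat_conj (val q)) == 1.
Proof. by rewrite quat_normsq_conj (valP q). Qed.

Definition sphere3_one : sphere3 := exist _ (quat 1 0 0 0) quat_normsq1.

Definition sphere3_mul (p q : sphere3) : sphere3 :=
  exist _ (quat_mul (val p) (val q)) (sphere3_mul_subproof p q).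

Definition sphere3_inv (q : sphere3) : sphere3 :=
  exist _ (quat_conj (val q)) (sphere3_inv_subproof q).

Lemma sphere3_mulA : associative sphere3_mul.
Proof.
by move=> p q r; apply/val_inj/quatP; rewrite /= !quatE; ring.
Qed.

Lemma sphere3_mul1g : left_id sphere3_one sphere3_mul.
Proof. by move=> q; apply/val_inj/quatP; rewrite /= !quatE; ring. Qed.

Lemma sphere3_mulg1 : right_id sphere3_one sphere3_mul.
Proof. by move=> q; apply/val_inj/quatP; rewrite /= !quatE; ring. Qed.

Lemma sphere3_mulVg : left_inverse sphere3_one sphere3_inv sphere3_mul.
Proof.
move=> q; have := eqP (valP q); rewrite quat_normsqE /= => q1.
by apply/val_inj/quatP; rewrite /= !quatE; try ring; rewrite -[RHS]q1; ring.
Qed.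

Lemma sphere3_mulgV : right_inverse sphere3_one sphere3_inv sphere3_mul.
Proof.
move=> q; have := eqP (valP q); rewrite quat_normsqE /= => q1.
by apply/val_inj/quatP; rewrite /= !quatE; try ring; rewrite -[RHS]q1; ring.
Qed.

HB.instance Definition _ := isGroup.Build sphere3
  sphere3_mulA sphere3_mul1g sphere3_mulg1 sphere3_mulVg sphere3_mulgV.

End UnitQuaternions.

Section RealAnalytic.
Variable R : realType.

Definition monomial n (a : {ffun 'I_n -> nat}) (h : 'rV[R]_n) : R :=
  \prod_i h 0 i ^+ a i.

Definition box_index n N (a : {ffun 'I_n -> 'I_N}) : {ffun 'I_n -> nat} :=
  [ffun i => a i : nat].

(* The series \sum_a c_a h^a over all multi-indices converges absolutely, with
   sum s; by absolute convergence its partial sums may be taken over the boxes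
   of multi-indices with all entries < N. *)
Definition power_series_sum n (c : {ffun 'I_n -> nat} -> R) (h : 'rV[R]_n)
    (s : R) : Prop :=
  cvgn (fun N : nat => \sum_(a : {ffun 'I_n -> 'I_N})
    `|c (box_index a) * monomial (box_index a) h|) /\
  (fun N : nat => \sum_(a : {ffun 'I_n -> 'I_N})
    c (box_index a) * monomial (box_index a) h) @ \oo --> s.

Definition analytic_at n (f : 'rV[R]_n -> R) (p : 'rV[R]_n) : Prop :=
  exists c : {ffun 'I_n -> nat} -> R,
    \forall x \near p, power_series_sum c (x - p) (f x).

Definition analytic_on n m (U : set 'rV[R]_n) (f : 'rV[R]_n -> 'rV[R]_m) :
  Prop := forall p, U p -> forall j, analytic_at (fun x => f x 0 j) p.

(* X and Y are regarded as subsets of Euclidean spaces through eX and eY: a map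
   between them is analytic when it is locally the restriction of an analytic
   map defined on an open subset of the ambient space. For embedded analytic
   submanifolds this is analyticity for the induced structures. *)
Definition analytic_map n m (X Y : Type) (eX : X -> 'rV[R]_n)
    (eY : Y -> 'rV[R]_m) (F : X -> Y) : Prop :=
  forall z : X, exists (U : set 'rV[R]_n) (g : 'rV[R]_n -> 'rV[R]_m),
    [/\ open U, U (eX z), analytic_on U g &
        forall z' : X, U (eX z') -> g (eX z') = eY (F z')].

Definition sphere3_pair_emb (q : sphere3 R * sphere3 R) : 'rV[R]_(4 + 4) :=
  row_mx (val q.1) (val q.2).

Definition analytic_diffeomorphism
    (F : sphere3 R * sphere3 R -> sphere3 R * sphere3 R) : Prop :=
  exists G : sphere3 R * sphere3 R -> sphere3 R * sphere3 R,
    [/\ cancel F G, cancel G F,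
        analytic_map sphere3_pair_emb sphere3_pair_emb F &
        analytic_map sphere3_pair_emb sphere3_pair_emb G].

Definition quaternionic_lift (A : 'M[int]_2)
    (F : sphere3 R * sphere3 R -> sphere3 R * sphere3 R) : Prop :=
  exists Phi : free2 -> free2,
    [/\ automorphism Phi, row_exponent_mx Phi = A & F = aut_map Phi].

End RealAnalytic.

(* These are the row exponent matrices of the elementary Nielsen
   transformations; a transvection 1 - e_ij is not itself elementary here, but
   is the product of three such matrices. *)
Definition elementary_mx (E : 'M[int]_2) : Prop :=
  exists i j : 'I_2, i != j /\
    [\/ E = tperm_mx i j,
        E = diag_mx (\row_k (-1) ^+ (k == i)) |
        E = 1%:M + delta_mx i j].

Definition elementary_nielsen (Psi : free2 -> free2) : Prop :=
  automorphism Psi /\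
  exists i j : 'I_2, i != j /\
    [\/ Psi (gen i) = gen j /\ Psi (gen j) = gen i,
        Psi (gen i) = ((gen i)^-1)%g /\ Psi (gen j) = gen j |
        (Psi (gen i) = (gen i * gen j)%g \/ Psi (gen i) = (gen j * gen i)%g) /\
        Psi (gen j) = gen j].

Definition nielsen_replacement (Es : seq 'M[int]_2)
    (Psis : seq (free2 -> free2)) : Prop :=
  List.Forall2 (fun E Psi => elementary_nielsen Psi /\ row_exponent_mx Psi = E)
    Es Psis.

(* [:: Psi_1; ...; Psi_k] is sent to Psi_k \o ... \o Psi_1: the order is
   reversed because row_exponent_mx is an anti-homomorphism. *)
Definition nielsen_compose (Psis : seq (free2 -> free2)) : free2 -> free2 :=
  foldr (fun Psi Phi => Phi \o Psi) id Psis.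

(* Main.v *)
(* A word in two unit quaternions is the restriction to S^3 x S^3 of a map of
   R^8 with polynomial coordinates, since inversion is conjugation on S^3. Hence
   F_Phi is analytic for every endomorphism Phi of F_2, and if Phi is an
   automorphism, then the inverse of F_Phi is F_(Phi^-1), also analytic. So it
   remains to lift A to an automorphism: Euclid's algorithm factors A into
   elementary matrices, each of these is the row exponent matrix of an
   elementary Nielsen transformation, and R is an anti-homomorphism. *)

Require Import Defs.
From mathcomp Require Import all_boot all_order all_fingroup all_algebra.
From mathcomp Require Import all_classical all_reals all_analysis.
From mathcomp Require Import ring zify.
Import Order.TTheory GRing.Theory Num.Theory.
Import numFieldNormedType.Exports.
Local Open Scope ring_scope.

(** * Universal property of the free group and functoriality of [aut_map] *)

Lemma ord2_case (k : 'I_2) : k = 0 \/ k = 1.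
Proof. by case: k => -[|[|//]] k2; [left | right]; apply/val_inj. Qed.

Lemma big_ord2 (V : nmodType) (F : 'I_2 -> V) : \sum_k F k = F 0 + F 1.
Proof.
rewrite !big_ord_recl big_ord0 addr0; congr (F _ + F _); exact/val_inj.
Qed.

(** Each letter evaluates to the corresponding one-letter word, so the product has underlying word
    [reduce (val w)], and a reduced word is its own reduction. This identity carries the universal
    property below. *)
Lemma word_map_id (w : free2) : word_map (gen 0, gen 1) w = w.
Proof.
have genE a : val (letter_map (gen 0, gen 1) a) = [:: a].
  by case: a => i b; case: (ord2_case i) => ->; case: b.
have valE s : val (\prod_(a <- s) letter_map (gen 0, gen 1%R) a)%g = reduce s.
  elim: s => [|a s IHs]; first by rewrite big_nil.
  have valM (u v : free2) : val (u * v)%g = reduce (val u ++ val v) by [].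
  by rewrite big_cons valM genE IHs reduce_catr.
by apply/val_inj; rewrite valE reduce_id ?(valP w).
Qed.

Section Morphisms.
Context (G : groupType) (f : free2 -> G).
Hypothesis fM : {morph f : u v / (u * v)%g}.

Lemma free2_morph1 : f 1%g = 1%g.
Proof. by apply: (mulgI (f 1%g)); rewrite -fM !mulg1. Qed.

Lemma free2_morphV : {morph f : u / (u^-1)%g}.
Proof.
by move=> u; apply: (mulgI (f u)); rewrite -fM !mulgV free2_morph1.
Qed.

Lemma free2_morph_letter q a :
  f (letter_map q a) = letter_map (f q.1, f q.2) a.
Proof.
by rewrite /letter_map; case: a => i [] /=; rewrite ?free2_morphV; case: ifP.
Qed.

Lemma free2_morph_word q w : f (word_map q w) = word_map (f q.1, f q.2) w.
Proof.
rewrite /word_map (big_morph _ fM free2_morph1).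
by apply: eq_bigr => a _; exact: free2_morph_letter.
Qed.

(** Uniqueness half of the universal property: write [w] as a word in the generators and push [f]
    through the product. *)
Lemma free2_universal w : f w = word_map (f (gen 0), f (gen 1)) w.
Proof. by rewrite -{1}[w]word_map_id free2_morph_word. Qed.

End Morphisms.

Lemma free2_morph_ext (f g : free2 -> free2) :
  {morph f : u v / (u * v)%g} -> {morph g : u v / (u * v)%g} ->
  f (gen 0) = g (gen 0) -> f (gen 1) = g (gen 1) -> f =1 g.
Proof.
move=> fM gM e0 e1 w.
by rewrite (free2_universal _ _ fM) e0 e1 -free2_universal.
Qed.

(** For fixed [q], evaluation at [q] after [Phi] is again a morphism, hence it is evaluation at the
    images of the generators, which form the pair [aut_map Phi q]. This substitution reverses the
    order of composition. *)
Lemma aut_map_comp (G : groupType) (Phi Psi : free2 -> free2) :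
  {morph Phi : u v / (u * v)%g} ->
  (@aut_map G (Phi \o Psi)) =1 aut_map Psi \o aut_map Phi.
Proof.
move=> PhiM q; have wE w : word_map q (Phi w) = word_map (aut_map Phi q) w.
  have M : {morph word_map q \o Phi : u v / (u * v)%g}.
    by move=> u v; rewrite /= PhiM word_mapM.
  exact: (free2_universal _ _ M).
by rewrite /= {1 2}/aut_map /= !wE.
Qed.

Lemma aut_map_id (G : groupType) : @aut_map G id =1 id.
Proof. by case=> q1 q2; rewrite /aut_map !word_map_gen. Qed.

Lemma automorphism_id : automorphism id.
Proof. by split=> //; exists id. Qed.

Lemma automorphism_comp (Phi Psi : free2 -> free2) :
  automorphism Phi -> automorphism Psi -> automorphism (Phi \o Psi).
Proof.
move=> [PhiM Phib] [PsiM Psib]; split; last exact: bij_comp.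
by move=> u v /=; rewrite PsiM PhiM.
Qed.

Lemma automorphism_inv (Phi : free2 -> free2) : automorphism Phi ->
  exists2 Psi, automorphism Psi & cancel Phi Psi /\ cancel Psi Phi.
Proof.
move=> [PhiM [Psi K K']]; exists Psi => //; split; last by exists Phi.
by move=> u v; apply: (can_inj K); rewrite PhiM !K'.
Qed.

(** * Exponent sums and the anti-homomorphism property of [row_exponent_mx] *)

Definition letter_exponent (j : 'I_2) (a : letter) : int :=
  if a.1 == j then (-1) ^+ a.2 else 0.

Lemma exponent_sumE j w :
  exponent_sum j w = \sum_(a <- val w) letter_exponent j a.
Proof. by rewrite /exponent_sum big_mkcond. Qed.

(** A letter and its inverse contribute opposite exponents, so cancellation during reduction leaves
    the sum unchanged, and over a concatenation the sum is additive. *)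
Lemma exponent_sumM j : {morph exponent_sum j : u v / (u * v)%g >-> u + v}.
Proof.
have red w : \sum_(a <- reduce w) letter_exponent j a =
             \sum_(a <- w) letter_exponent j a.
  elim: w => //= a w IHw; rewrite -/(reduce w) big_cons -IHw.
  case: (reduce w) => [|b s] /=; first by rewrite big_cons.
  case: eqP => [->|_]; last by rewrite !big_cons.
  rewrite big_cons addrA -[LHS]add0r; congr (_ + _).
  by case: a {IHw} => i []; rewrite /letter_exponent /=; case: eqP; lia.
by move=> u v; rewrite !exponent_sumE /= red big_cat.
Qed.

Lemma exponent_sum1 j : exponent_sum j 1%g = 0.
Proof. by rewrite exponent_sumE big_nil. Qed.

Lemma exponent_sumV j u : exponent_sum j (u^-1)%g = - exponent_sum j u.
Proof.
apply: (addrI (exponent_sum j u)).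
by rewrite -exponent_sumM mulgV exponent_sum1 subrr.
Qed.

Lemma exponent_sum_gen j i : exponent_sum j (gen i) = (i == j)%:R.
Proof. by rewrite exponent_sumE big_seq1 /letter_exponent /=; case: eqP. Qed.

(** After substitution, each occurrence of a generator in [w] contributes the exponents of its
    image. This is one entry of the matrix product in [row_exponent_mx_comp]. *)
Lemma exponent_sum_word j (u v w : free2) :
  exponent_sum j (word_map (u, v) w) =
  exponent_sum 0 w * exponent_sum j u + exponent_sum 1 w * exponent_sum j v.
Proof.
rewrite /word_map (big_morph _ (exponent_sumM j) (exponent_sum1 j)).
rewrite !(exponent_sumE _ w) !mulr_suml -big_split; apply: eq_bigr => a _ /=.
rewrite /letter_exponent /letter_map; case: a => i b /=.
by case: (ord2_case i) => ->; case: b; rewrite /= ?exponent_sumV; lia.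
Qed.

Lemma row_exponent_mx_comp (Phi Psi : free2 -> free2) :
  {morph Phi : u v / (u * v)%g} ->
  row_exponent_mx (Phi \o Psi) = row_exponent_mx Psi *m row_exponent_mx Phi.
Proof.
move=> PhiM; apply/matrixP => i j; rewrite !mxE big_ord2 !mxE /=.
by rewrite (free2_universal _ _ PhiM) exponent_sum_word.
Qed.

Lemma row_exponent_mx_id : row_exponent_mx id = 1%:M.
Proof. by apply/matrixP => i j; rewrite !mxE exponent_sum_gen. Qed.

(** * Elementary matrices as row exponent matrices of elementary Nielsen transformations *)

(** The images are an indexed family, so that the elementary operations can be written uniformly in
    the indices [i] and [j]. *)
Definition endo (u : 'I_2 -> free2) : free2 -> free2 := word_map (u 0, u 1).

Lemma endoM u : {morph endo u : v w / (v * w)%g}.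
Proof. exact: word_mapM. Qed.

Lemma endo_gen u k : endo u (gen k) = u k.
Proof. by rewrite /endo; case: (ord2_case k) => ->; rewrite word_map_gen. Qed.

Lemma endo_cancel u v :
  (forall k, endo v (u k) = gen k) -> cancel (endo u) (endo v).
Proof.
move=> uv; apply: (free2_morph_ext (endo v \o endo u) id) => //=.
- by move=> w w'; rewrite /= !endoM.
- by rewrite endo_gen.
- by rewrite endo_gen.
Qed.

Lemma endo_automorphism u v : (forall k, endo v (u k) = gen k) ->
  (forall k, endo u (v k) = gen k) -> automorphism (endo u).
Proof.
move=> uv vu; split; first exact: endoM.
by exists (endo v); exact: endo_cancel.
Qed.

Lemma ord2_neq (i j k : 'I_2) : i != j -> k != i -> k = j.
Proof.
case: (ord2_case i) => ->; case: (ord2_case j) => ->;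
  by case: (ord2_case k) => ->.
Qed.

(** The interchange and the inversion are involutions; right multiplication of [gen i] by [gen j] is
    undone by right multiplication by the inverse of [gen j]. Bijectivity is thus checked on
    generators. *)
Lemma elementary_nielsen_exists (E : 'M[int]_2) : elementary_mx E ->
  exists Psi, elementary_nielsen Psi /\ row_exponent_mx Psi = E.
Proof.
move=> [i [j [ij]]]; have ji : (j == i) = false by rewrite eq_sym (negPf ij).
have kij k : k = i \/ k = j.
  by case: (eqVneq k i) => [|/(ord2_neq _ _ _ ij)]; [left | right].
have endoV u w : endo u (w^-1)%g = ((endo u w)^-1)%g.
  exact: free2_morphV (endoM u) w.
case=> ->.
- pose u k := gen (tperm i j k); exists (endo u).
  have uK k : endo u (u k) = gen k by rewrite endo_gen /u tpermK.
  split; last first.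
    by apply/matrixP => k l; rewrite !mxE endo_gen /u exponent_sum_gen.
  split; first exact: (endo_automorphism _ _ uK uK).
  by exists i, j; split=> //; apply: Or31; rewrite !endo_gen /u tpermL tpermR.
- pose u k := if k == i then ((gen i)^-1)%g else gen k; exists (endo u).
  have uK k : endo u (u k) = gen k.
    rewrite {2}/u; case: eqP => [->|/eqP/negPf ki]; last first.
      by rewrite endo_gen /u ki.
    by rewrite endoV endo_gen /u eqxx invgK.
  split; last first.
    apply/matrixP => k l; rewrite !mxE endo_gen /u.
    case: (eqVneq k i) => [->|ki]; rewrite ?exponent_sumV exponent_sum_gen.
      by rewrite ?eqxx; case: (i == l).
    by rewrite ?(negPf ki); case: (k == l).
  split; first exact: (endo_automorphism _ _ uK uK).
  by exists i, j; split=> //; apply: Or32; rewrite !endo_gen /u eqxx ji.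
- pose u k := if k == i then (gen i * gen j)%g else gen k.
  pose v k := if k == i then (gen i * (gen j)^-1)%g else gen k; exists (endo u).
  have uv k : endo v (u k) = gen k.
    rewrite /u; case: eqP => [->|/eqP/negPf ki]; last by rewrite endo_gen /v ki.
    by rewrite endoM !endo_gen /v eqxx ji mulgVK.
  have vu k : endo u (v k) = gen k.
    rewrite /v; case: eqP => [->|/eqP/negPf ki]; last by rewrite endo_gen /u ki.
    by rewrite endoM endoV !endo_gen /u eqxx ji mulgK.
  split; last first.
    apply/matrixP => k l; rewrite !mxE endo_gen /u.
    case: (eqVneq k i) => [->|ki] /=; rewrite ?exponent_sumM !exponent_sum_gen.
      by rewrite (eq_sym l).
    by rewrite addr0.
  split; first exact: endo_automorphism _ _ uv vu.
  exists i, j; split=> //; apply: Or33; rewrite !endo_gen /u eqxx ji.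
  by split=> //; left.
Qed.

(** * Factorization of invertible integral matrices by Euclid's algorithm *)

Lemma mx2P (A B : 'M[int]_2) : A 0 0 = B 0 0 -> A 0 1 = B 0 1 ->
  A 1 0 = B 1 0 -> A 1 1 = B 1 1 -> A = B.
Proof.
move=> e00 e01 e10 e11; apply/matrixP => i j.
by case: (ord2_case i) => ->; case: (ord2_case j) => ->.
Qed.

Lemma det_mx2 (A : 'M[int]_2) : \det A = A 0 0 * A 1 1 - A 0 1 * A 1 0.
Proof.
have l0 : lift 0%R 0%R = 1 :> 'I_2 by exact/val_inj.
have l1 : lift 1%R 0%R = 0 :> 'I_2 by exact/val_inj.
rewrite (expand_det_row A 0) big_ord2 /cofactor !det_mx11 !mxE /= l0 l1.
rewrite /bump /=; ring.
Qed.

Definition elementary_product (A : 'M[int]_2) : Prop :=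
  exists Es : seq 'M[int]_2,
    (forall E, E \in Es -> elementary_mx E) /\ A = \prod_(E <- Es) E.

Lemma elementary_product1 : elementary_product 1.
Proof. by exists [::]; rewrite big_nil. Qed.

Lemma elementary_productM A B :
  elementary_product A -> elementary_product B -> elementary_product (A * B).
Proof.
move=> [s [hs ->]] [t [ht ->]]; exists (s ++ t); rewrite big_cat; split=> // E.
by rewrite mem_cat => /orP[/hs|/ht].
Qed.

Lemma elementary_product_elementary E : elementary_mx E -> elementary_product E.
Proof.
by move=> hE; exists [:: E]; rewrite big_seq1; split=> // F /[!inE] /eqP ->.
Qed.

Lemma elementary_product_swap : elementary_product (tperm_mx 0 1).
Proof.
by apply: elementary_product_elementary; exists 0, 1; split=> //; apply: Or31.
Qed.

Lemma elementary_product_sign i :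
  elementary_product (diag_mx (\row_k (-1) ^+ (k == i))).
Proof.
(* [1 - i] is the other index of ['I_2]; [elementary_mx] asks for a pair of distinct indices. *)
apply: elementary_product_elementary; exists i, (1 - i).
by split; [case: (ord2_case i) => -> | apply: Or32].
Qed.

(** For [t >= 0] this is a power of the elementary transvection. Conjugation by the diagonal matrix
    with entries -1 and 1 changes the sign of [t], which gives the negative case. *)
Lemma elementary_product_transvection (t : int) :
  elementary_product (1 + t *: delta_mx 0 1).
Proof.
have pos (n : nat) : elementary_product (1 + n%:Z *: delta_mx 0 1).
  elim: n => [|n IHn].
    by rewrite scale0r addr0; exact: elementary_product1.
  suff -> : 1 + n.+1%:Z *: delta_mx 0 1 =
      (1 + n%:Z *: delta_mx 0 1) * (1 + delta_mx 0 1) :> 'M[int]_2.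
    apply: elementary_productM => //; apply: elementary_product_elementary.
    by exists 0, 1; split=> //; apply: Or33.
  by apply: mx2P; rewrite !mxE big_ord2 !mxE /=; lia.
case: t => n; first exact: pos.
pose D : 'M[int]_2 := diag_mx (\row_k (-1) ^+ (k == 0)).
suff -> : 1 + (Negz n) *: delta_mx 0 1 =
    D * ((1 + n.+1%:Z *: delta_mx 0 1) * D) :> 'M[int]_2.
  by do 2?apply: elementary_productM => //; exact: elementary_product_sign.
by apply: mx2P; rewrite !(mxE, big_ord2) /=; lia.
Qed.

Lemma elementary_product_diag (a d : int) :
  a = 1 \/ a = -1 -> d = 1 \/ d = -1 ->
  elementary_product (diag_mx (\row_k if k == 0 then a else d)).
Proof.
move=> ha hd.
have one i (x : int) : x = 1 \/ x = -1 ->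
    elementary_product (diag_mx (\row_k if k == i then x else 1)).
  case=> ->.
    rewrite (_ : diag_mx _ = 1); first exact: elementary_product1.
    by apply/matrixP => k l; rewrite !mxE; case: ifP.
  have := elementary_product_sign i; congr (elementary_product (diag_mx _)).
  by apply/rowP => k; rewrite !mxE; case: eqP.
have := elementary_productM _ _ (one 0 a ha) (one 1 d hd).
congr elementary_product.
by apply: mx2P; rewrite !(mxE, big_ord2) /=; lia.
Qed.

(** Strong induction on the absolute value of the lower left entry: row operations run Euclid's
    algorithm on the first column until the matrix is upper triangular. *)
Lemma elementary_product_unitmx (A : 'M[int]_2) :
  A \in unitmx -> elementary_product A.
Proof.
rewrite unitmxE => uA.
have {uA} : \det A = 1 \/ \det A = -1.
  by case/orP: uA => /eqP; [left | right].
rewrite det_mx2.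
have [n] := ubnP (absz (A 1 0)); elim: n A => // n IHn A leAn detA.
have [c0|c0] := eqVneq (A 1 0) 0.
  rewrite c0 mulr0 subr0 in detA.
  have /eqP : (absz (A 0 0)%R * absz (A 1 1)%R = 1)%N.
    by rewrite -abszM; case: detA => ->.
  rewrite muln_eq1 => /andP[/eqP a1 /eqP d1].
  have ha : A 0 0 = 1 \/ A 0 0 = -1 by lia.
  have hd : A 1 1 = 1 \/ A 1 1 = -1 by lia.
  (* Writing a, b, d for the entries of the triangular matrix, the product has upper right entry (d
     b) d, which equals b because d is 1 or -1. *)
  have := elementary_productM _ _
     (elementary_product_transvection (A 1 1 * A 0 1))
     (elementary_product_diag _ _ ha hd).
  congr elementary_product.
  by apply: mx2P; rewrite !(mxE, big_ord2) /= ?c0; nia.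
(* One Euclidean step: subtract [t] times the second row from the first, then swap the rows. The new
   lower left entry is the remainder of [A 0 0] modulo [A 1 0]. *)
pose t := divz (A 0 0) (A 1 0).
pose B : 'M[int]_2 := tperm_mx 0 1 * ((1 + (- t) *: delta_mx 0 1) * A).
have BE : [/\ B 0 0 = A 1 0, B 0 1 = A 1 1, B 1 0 = A 0 0 - t * A 1 0 &
    B 1 1 = A 0 1 - t * A 1 1].
  by rewrite /B; split; rewrite !(mxE, big_ord2) /= ?tpermL ?tpermR /=; lia.
case: BE => B00 B01 B10 B11.
have -> : A = (1 + t *: delta_mx 0 1) * (tperm_mx 0 1 * B).
  apply: mx2P; rewrite !(mxE, big_ord2) /= ?tpermL ?tpermR /=;
    by rewrite ?B00 ?B01 ?B10 ?B11; lia.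
apply: elementary_productM; first exact: elementary_product_transvection.
apply: elementary_productM; first exact: elementary_product_swap.
(* The swap changes the sign of the determinant, so it stays 1 or -1; the remainder is nonnegative
   and smaller than the absolute value of the divisor. *)
apply: IHn; last by rewrite B00 B01 B10 B11; lia.
rewrite B10.
have := divz_eq (A 0 0) (A 1 0); have := modz_ge0 (A 0 0) c0.
have := ltz_mod (A 0 0) c0; rewrite -/t; lia.
Qed.

(** * Polynomial functions are analytic *)

Section Polynomials.
Context (R : realType) (n : nat).
Implicit Types (f g : 'rV[R]_n -> R) (p x : 'rV[R]_n).

(** Exponents may repeat in the list, so sums are concatenations and products are lists of pairwise
    products; like terms are collected only when the power series is formed. *)
Definition monomial_sum (s : seq (R * {ffun 'I_n -> nat})) x : R :=
  \sum_(t <- s) t.1 * monomial t.2 x.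

(** Expanding in [x - p] gives the form required by [analytic_at], so no change of centre is ever
    computed. *)
Definition polynomial_at p f : Prop :=
  exists s, forall x, f x = monomial_sum s (x - p).

Lemma polynomial_at_ext p f g :
  f =1 g -> polynomial_at p g -> polynomial_at p f.
Proof. by move=> fg [s gE]; exists s => x; rewrite fg. Qed.

Lemma polynomial_at_cst p c : polynomial_at p (fun=> c).
Proof.
exists [:: (c, [ffun=> 0%N])] => x; rewrite /monomial_sum big_seq1 /= /monomial.
by rewrite big1 ?mulr1// => i _; rewrite ffunE expr0.
Qed.

Lemma polynomial_atD p f g : polynomial_at p f -> polynomial_at p g ->
  polynomial_at p (fun x => f x + g x).
Proof.
move=> [s fE] [t gE]; exists (s ++ t) => x.
by rewrite /monomial_sum big_cat -/(monomial_sum _ _) fE gE.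
Qed.

Lemma monomialD (a b : {ffun 'I_n -> nat}) x :
  monomial [ffun i => (a i + b i)%N] x = monomial a x * monomial b x.
Proof.
by rewrite /monomial -big_split; apply: eq_bigr => i _; rewrite ffunE exprD.
Qed.

Lemma polynomial_atM p f g : polynomial_at p f -> polynomial_at p g ->
  polynomial_at p (fun x => f x * g x).
Proof.
move=> [s fE] [t gE].
pose mul (u v : R * {ffun 'I_n -> nat}) : R * {ffun 'I_n -> nat} :=
  (u.1 * v.1, [ffun i => (u.2 i + v.2 i)%N]).
exists [seq mul u v | u <- s, v <- t] => x.
rewrite fE gE /monomial_sum big_allpairs_dep mulr_suml; apply: eq_bigr => u _.
by rewrite mulr_sumr; apply: eq_bigr => v _; rewrite monomialD mulrACA.
Qed.

Lemma polynomial_atN p f :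
  polynomial_at p f -> polynomial_at p (fun x => - f x).
Proof.
move=> fP; have := polynomial_atM _ _ _ (polynomial_at_cst p (-1)) fP.
by move=> [s sE]; exists s => x; rewrite -sE mulN1r.
Qed.

Lemma polynomial_at_coord p i : polynomial_at p (fun x => x 0 i).
Proof.
exists [:: (1, [ffun k => (k == i) : nat]); (p 0 i, [ffun=> 0%N])] => x.
rewrite /monomial_sum big_cons big_seq1 /= /monomial.
rewrite (bigD1 i) //= ffunE eqxx expr1 big1 ?mulr1; last first.
  by move=> k /negPf ki; rewrite ffunE ki expr0.
rewrite big1 ?mulr1; last by move=> k _; rewrite ffunE expr0.
by rewrite mul1r !mxE subrK.
Qed.

(** The coefficient of a multi-index collects all terms of the list with that exponent. The partial
    sums over boxes are then constant once the box contains every exponent, and this holds at every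
    [x], not only near [p]. *)
Lemma polynomial_at_analytic p f : polynomial_at p f -> analytic_at f p.
Proof.
move=> [s fE]; pose c (a : {ffun 'I_n -> nat}) := \sum_(t <- s | t.2 == a) t.1.
exists c; apply: (filterE (F := nbhs p)) => x; set h := x - p.
have [M degM] : exists M, forall t i, t \in s -> (t.2 i < M)%N.
  exists (\max_(t <- s) \max_i t.2 i).+1 => t i ts; rewrite ltnS.
  pose deg (u : R * {ffun 'I_n -> nat}) := \max_i u.2 i.
  have := leq_bigmax_seq (P := predT) (F := deg) t ts isT; apply: leq_trans.
  exact: (leq_bigmax (F := t.2) i).
(* The weight e covers both the series itself and, with e the sign of the
   terms, the series of absolute values. *)
have box e N : (M <= N)%N ->
    \sum_(a : {ffun 'I_n -> 'I_N})
      e (box_index a) * (c (box_index a) * monomial (box_index a) h) =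
    \sum_(t <- s) e t.2 * (t.1 * monomial t.2 h).
  move=> MN; under eq_bigr do rewrite /c mulr_suml mulr_sumr big_mkcond.
  rewrite exchange_big big_seq [RHS]big_seq; apply: eq_bigr => t ts.
  (* After the exchange of sums, each term [t] meets exactly one index of the box, its own exponent
     vector [a]. *)
  have tN i : (t.2 i < N)%N by exact: leq_trans (degM t i ts) MN.
  pose a : {ffun 'I_n -> 'I_N} := [ffun i => Ordinal (tN i)].
  have ta : t.2 = box_index a by apply/ffunP => i; rewrite !ffunE.
  rewrite (bigD1 a) //= -ta eqxx big1 ?addr0 // => b /negP ba.
  case: eqP => // tb; case: ba; apply/eqP/ffunP => i; apply/val_inj.
  have := congr1 (fun u : {ffun 'I_n -> nat} => u i) tb.
  by rewrite !ffunE /= => <-.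
split.
  apply/cvg_ex; exists (\sum_(t <- s) Num.sg (c t.2 * monomial t.2 h) *
    (t.1 * monomial t.2 h)).
  apply: cvg_near_cst; exists M => // N /= MN.
  rewrite -(box (fun a => Num.sg (c a * monomial a h)) N MN).
  by apply: eq_bigr => a _; rewrite normrEsg.
rewrite (_ : f x = \sum_(t <- s) 1 * (t.1 * monomial t.2 h)); last first.
  by rewrite fE; apply: eq_bigr => t _; rewrite mul1r.
apply: cvg_near_cst; exists M => // N /= MN; rewrite -(box (fun=> 1) N MN).
by apply: eq_bigr => a _; rewrite mul1r.
Qed.

End Polynomials.

(** * Words in unit quaternions as restrictions of polynomial maps *)

Section Spheres.
Context (R : realType).
Implicit Types (x p : 'rV[R]_(4 + 4)) (h k : 'rV[R]_(4 + 4) -> 'rV[R]_4).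

Definition quat_polynomial_at p h : Prop :=
  forall j, polynomial_at R _ p (fun x => h x 0 j).

Lemma quat_polynomial_at_quat p (a b c d : 'rV[R]_(4 + 4) -> R) :
  polynomial_at R _ p a -> polynomial_at R _ p b ->
  polynomial_at R _ p c -> polynomial_at R _ p d ->
  quat_polynomial_at p (fun x => quat (a x) (b x) (c x) (d x)).
Proof.
move=> pa pb pc pd j; rewrite (_ : (fun x => _) =
    nth (fun=> 0) [:: a; b; c; d] j); last first.
  by apply/funext => x; rewrite mxE; case: j => -[|[|[|[|]]]].
by case: j => -[|[|[|[|]]]].
Qed.

Lemma quat_polynomial_at_mul p h k :
  quat_polynomial_at p h -> quat_polynomial_at p k ->
  quat_polynomial_at p (fun x => quat_mul (h x) (k x)).
Proof.
move=> ph pk; apply: quat_polynomial_at_quat;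
  by repeat first [exact: ph | exact: pk | apply: polynomial_atD |
                   apply: polynomial_atN | apply: polynomial_atM].
Qed.

Lemma quat_polynomial_at_conj p h :
  quat_polynomial_at p h -> quat_polynomial_at p (fun x => quat_conj (h x)).
Proof.
move=> ph; apply: quat_polynomial_at_quat; try exact: ph.
all: by apply: polynomial_atN; exact: ph.
Qed.

(** Conjugation replaces inversion: it is polynomial on all of the ambient space and agrees with the
    inverse on unit quaternions. *)
Definition quat_letter x (a : letter) : 'rV[R]_4 :=
  let g := if a.1 == 0 then lsubmx x else rsubmx x in
  if a.2 then quat_conj g else g.

Definition quat_word (w : seq letter) x : 'rV[R]_4 :=
  foldr (fun a g => quat_mul (quat_letter x a) g) (quat 1 0 0 0) w.

Lemma quat_polynomial_at_word p w : quat_polynomial_at p (quat_word w).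
Proof.
elim: w => [|a w IHw].
  by apply: quat_polynomial_at_quat; exact: polynomial_at_cst.
apply: quat_polynomial_at_mul IHw; rewrite /quat_letter.
have gP : quat_polynomial_at p
    (fun x => if a.1 == 0 then lsubmx x else rsubmx x).
  move=> j; case: (a.1 == 0).
    apply: polynomial_at_ext (polynomial_at_coord _ _ p (lshift 4 j)) => x.
    by rewrite mxE.
  apply: polynomial_at_ext (polynomial_at_coord _ _ p (rshift 4 j)) => x.
  by rewrite mxE.
by case: a.2 => //; exact: quat_polynomial_at_conj.
Qed.

Lemma quat_word_emb (q : sphere3 R * sphere3 R) (w : free2) :
  quat_word (val w) (sphere3_pair_emb q) = val (word_map q w).
Proof.
case: w => w rw; rewrite /word_map /=.
elim: w {rw} => [|a s IHs]; first by rewrite big_nil.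
have -> : quat_word (a :: s) (sphere3_pair_emb q) =
    quat_mul (quat_letter (sphere3_pair_emb q) a)
             (quat_word s (sphere3_pair_emb q)) by [].
have valM (u v : sphere3 R) : val (u * v)%g = quat_mul (val u) (val v) by [].
rewrite IHs big_cons valM; congr (quat_mul _ _).
rewrite /quat_letter /letter_map /sphere3_pair_emb row_mxKl row_mxKr.
by case: a => i [] /=; case: ifP.
Qed.

(** The polynomial extension is global, so a single chart domain, the whole space, serves every
    point. *)
Lemma analytic_aut_map (Phi : free2 -> free2) :
  analytic_map (@sphere3_pair_emb R) (@sphere3_pair_emb R) (aut_map Phi).
Proof.
move=> z; exists setT, (fun x =>
  row_mx (quat_word (val (Phi (gen 0))) x) (quat_word (val (Phi (gen 1))) x)).
split=> //.
- exact: openT.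
- move=> p _ j; apply: polynomial_at_analytic.
  have [i -> | i ->] := split_ordP j.
    by apply: polynomial_at_ext (quat_polynomial_at_word p _ i) => x;
      rewrite row_mxEl.
  by apply: polynomial_at_ext (quat_polynomial_at_word p _ i) => x;
      rewrite row_mxEr.
- by move=> q _; rewrite !quat_word_emb.
Qed.

Lemma aut_map_diffeomorphism (Phi : free2 -> free2) : automorphism Phi ->
  analytic_diffeomorphism
    (aut_map Phi : sphere3 R * sphere3 R -> sphere3 R * sphere3 R).
Proof.
move=> PhiA; have [Psi PsiA [K K']] := automorphism_inv _ PhiA.
(* Contravariance turns a left inverse on words into a right inverse on pairs, hence the exchanged
   roles of [f] and [g]. *)
have cancelA (f g : free2 -> free2) : {morph g : u v / (u * v)%g} ->
    cancel f g -> cancel (@aut_map (sphere3 R) g) (aut_map f).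
  move=> gM fg q; rewrite -[LHS](aut_map_comp _ _ f gM q).
  by rewrite /aut_map /= !fg !word_map_gen; case: q.
exists (aut_map Psi); split; try exact: analytic_aut_map.
- exact: (cancelA _ _ PhiA.1).
- exact: (cancelA _ _ PsiA.1).
Qed.

End Spheres.

(** * Composing Nielsen transformations along a factorization *)

Lemma nielsen_compose_cons Psi Psis :
  nielsen_compose (Psi :: Psis) = nielsen_compose Psis \o Psi.
Proof. by []. Qed.

Lemma nielsen_replacement_exists (Es : seq 'M[int]_2) :
  (forall E, E \in Es -> elementary_mx E) ->
  exists Psis, nielsen_replacement Es Psis.
Proof.
elim: Es => [|E Es IHEs] hEs; first by exists [::]; constructor.
have [Psi PsiE] := elementary_nielsen_exists E (hEs E (mem_head _ _)).
have [|Psis PsisEs] := IHEs.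
  by move=> F hF; apply: hEs; rewrite inE hF orbT.
by exists (Psi :: Psis); constructor.
Qed.

(** Both [row_exponent_mx] and [aut_map] reverse composition, which undoes the reversal in
    [nielsen_compose]: matrices and maps come out in the order of the list. *)
Lemma nielsen_composeP (G : groupType) Es Psis : nielsen_replacement Es Psis ->
  [/\ automorphism (nielsen_compose Psis),
      row_exponent_mx (nielsen_compose Psis) = \prod_(E <- Es) E &
      @aut_map G (nielsen_compose Psis) =1
        foldr (fun Psi F => aut_map Psi \o F) id Psis].
Proof.
elim=> {Es Psis} [|E Psi Es Psis [[PsiA _] <-] _ [PhiA PhiE PhiF]].
  split; [exact: automorphism_id | | exact: aut_map_id].
  by rewrite big_nil row_exponent_mx_id.
rewrite nielsen_compose_cons; split; first exact: automorphism_comp.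
  by rewrite big_cons (row_exponent_mx_comp _ _ PhiA.1) PhiE.
by move=> q; rewrite (aut_map_comp _ _ _ PhiA.1) /= PhiF.
Qed.

Theorem theorem3p2 (R : realType) (A : 'M[int]_2) (hA : A \in unitmx) :
  (exists F : sphere3 R * sphere3 R -> sphere3 R * sphere3 R,
     quaternionic_lift A F /\ analytic_diffeomorphism F) /\
  (exists Es : seq 'M[int]_2,
     (forall E, E \in Es -> elementary_mx E) /\ A = \prod_(E <- Es) E) /\
  (forall Es : seq 'M[int]_2,
     (forall E, E \in Es -> elementary_mx E) -> A = \prod_(E <- Es) E ->
     (exists Psis : seq (free2 -> free2), nielsen_replacement Es Psis) /\
     (forall Psis : seq (free2 -> free2), nielsen_replacement Es Psis ->
        let Phi := nielsen_compose Psis in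
        [/\ automorphism Phi,
            row_exponent_mx Phi = A,
            (aut_map Phi : sphere3 R * sphere3 R -> sphere3 R * sphere3 R) =1
              foldr (fun Psi F => aut_map Psi \o F) id Psis &
            analytic_diffeomorphism
              (aut_map Phi : sphere3 R * sphere3 R -> sphere3 R * sphere3 R)])).
Proof.
have part3 (Es : seq 'M[int]_2) (Psis : seq (free2 -> free2)) :
    A = \prod_(E <- Es) E -> nielsen_replacement Es Psis ->
    [/\ automorphism (nielsen_compose Psis),
        row_exponent_mx (nielsen_compose Psis) = A,
        @aut_map (sphere3 R) (nielsen_compose Psis) =1
          foldr (fun Psi F => aut_map Psi \o F) id Psis &
        analytic_diffeomorphism (@aut_map (sphere3 R) (nielsen_compose Psis))].
  move=> -> /(nielsen_composeP (sphere3 R))[PhiA PhiE PhiF].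
  by split=> //; exact: aut_map_diffeomorphism.
have [Es [hEs AE]] := elementary_product_unitmx A hA.
split; last split; last 1 first.
- move=> Fs hFs AF; split; first exact: nielsen_replacement_exists.
  by move=> Psis; exact: part3.
(* The lift in the first claim is the one attached to the factorization found by Euclid's
   algorithm. *)
- have [Psis /(part3 _ _ AE)[PhiA PhiE _ Phian]] :=
    nielsen_replacement_exists Es hEs.
  exists (aut_map (nielsen_compose Psis)); split=> //.
  by exists (nielsen_compose Psis).
- by exists Es.
Qed.
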